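(* Let $\mathcal{H}$ be a real Hilbert space, let $A\colon\mathcal{H}\to 2^{\mathcal{H}}$ and $B\colon\mathcal{H}\to 2^{\mathcal{H}}$ be maximally monotone, suppose that $\mathrm{zer}(A+B)\neq\varnothing$, let $y_0\in\mathcal{H}$, let $(\lambda_n)_{n\in\mathbb{N}}$ be a sequence in $]0,1]$ such that $\inf_{n\in\mathbb{N}}\lambda_n>0$, and let $\gamma\in\,]0,+\infty[$. Iterate, for every $n\in\mathbb{N}$, $$x_n=J_{\gamma B}y_n,\quad x_n^*=\gamma^{-1}(y_n-x_n),\quad z_n=J_{\gamma A}(2x_n-y_n),\quad y_{n+1}=\mathsf{Q}\bigl(y_0,y_n,y_n+\lambda_n(z_n-x_n)\bigr).$$ Let $Z=\{x\in\mathcal{H}\mid 0\in Ax+Bx\}$ and $Z^*=\{x^*\in\mathcal{H}\mid 0\in-A^{-1}(-x^* )+B^{-1}x^*\}$. Then the following hold: (i) $(x_n)_{n\in\mathbb{N}}$ converges strongly to a point in $Z$. (ii) $(x_n^* )_{n\in\mathbb{N}}$ converges strongly to a point in $Z^*$.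
   Context: For $M\colon\mathcal{H}\to2^{\mathcal{H}}$, $\mathrm{zer}\,M=\{x\mid 0\in Mx\}$, $M^{-1}$ is the set-valued inverse, and $J_M=(\mathrm{Id}+M)^{-1}$ is the resolvent (single-valued and defined everywhere when $M$ is maximally monotone). $M$ is maximally monotone if it is monotone and no monotone operator has a graph strictly containing that of $M$. For $(x,y)\in\mathcal{H}^2$, $H(x,y)=\{z\in\mathcal{H}\mid\langle z-y\mid x-y\rangle\leq 0\}$; for $(x,y,z)\in\mathcal{H}^3$ such that $H(x,y)\cap H(y,z)\neq\varnothing$, $\mathsf{Q}(x,y,z)$ is the projection of $x$ onto $H(x,y)\cap H(y,z)$. *)

(* Defs.v *)
From HB Require Import structures.
From mathcomp Require Import all_boot all_order all_algebra.
From mathcomp Require Import all_classical all_reals all_analysis.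
Set Implicit Arguments.
Unset Strict Implicit.
Unset Printing Implicit Defensive.
Import Order.TTheory GRing.Theory Num.Theory numFieldNormedType.Exports.
Local Open Scope classical_set_scope.
Local Open Scope ring_scope.

(* A real Hilbert space is a complete normed module [H] over [R : realType]
   together with a positive definite symmetric bilinear form
   [dot : {dot H for idfun}] such that [`|u| ^+ 2 = dot u u] for all [u].  An
   operator from H to 2^H is a function [H -> set H]. *)

Section SetValuedOperators.
Context {R : realType} {H : completeNormedModType R}.
Implicit Types (M N : H -> set H).

Definition op_id : H -> set H := fun x => [set x].

Definition op_add M N : H -> set H :=
  fun x => [set u + v | u in M x & v in N x].

Definition op_scale (c : R) M : H -> set H := fun x => [set c *: u | u in M x].

Definition op_inv M : H -> set H := fun u => [set x | M x u].

Definition graph M : set (H * H) := [set p | M p.1 p.2].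

Definition zer M : set H := [set x | M x 0].

(* [(Id + M)^-1] as a point-valued map.  It is only meaningful at those [y]
   where [op_inv (op_add op_id M) y] is a singleton; if that set is empty, the
   value is the dummy [0]. *)
Definition resolvent M (y : H) : H := xget 0 (op_inv (op_add op_id M) y).

Definition primal_solutions (A B : H -> set H) : set H :=
  [set x | op_add A B x 0].

(* the points x* such that 0 lies in - A^-1(- x* ) + B^-1 x* *)
Definition dual_solutions (A B : H -> set H) : set H :=
  [set xs | op_add (fun u => [set - a | a in op_inv A (- u)]) (op_inv B) xs 0].

Definition is_projection (C : set H) (x p : H) : Prop :=
  C p /\ forall w, C w -> `|x - p| <= `|x - w|.

(* If [x] has no projection onto [C], the value is the dummy [0]. *)
Definition projection (C : set H) (x : H) : H := xget 0 (is_projection C x).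

End SetValuedOperators.

Section InnerProduct.
Context {R : realType} {H : completeNormedModType R}.
Variable dot : {dot H for idfun}.

Definition monotone (M : H -> set H) : Prop :=
  forall x u y v, M x u -> M y v -> 0 <= dot (x - y) (u - v).

Definition maximally_monotone (M : H -> set H) : Prop :=
  monotone M /\ forall N, monotone N -> ~ (graph M `<` graph N).

Definition half_space (x y : H) : set H := [set z | dot (z - y) (x - y) <= 0].

Definition haugazeau (x y z : H) : H :=
  projection (half_space x y `&` half_space y z) x.

End InnerProduct.

(* Main.v *)
Require Import Defs.
From HB Require Import structures.
From mathcomp Require Import all_boot all_order all_algebra.
From mathcomp Require Import all_classical all_reals all_analysis.
From mathcomp Require Import ring lra.
Set Implicit Arguments.
Unset Strict Implicit.
Unset Printing Implicit Defensive.
Import Order.TTheory GRing.Theory Num.Theory numFieldNormedType.Exports.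
Local Open Scope classical_set_scope.
Local Open Scope ring_scope.

(* The Douglas-Rachford operator [T y = y + J_A (2 J_B y - y) - J_B y] (with
   [J_A], [J_B] the resolvents of [gamma A], [gamma B]) is firmly nonexpansive,
   its fixed points [l] are those for which [J_B l] and [(l - J_B l) / gamma]
   solve the primal and the dual problem, and the iteration is Haugazeau's
   method for projecting [y0] onto the fixed points of [T].  Since [J_B] is
   continuous, it is enough that [y n] converges strongly to some fixed point.

   Weak compactness is avoided.  Let [p_k] be the solution of
   [(k + 1) (p_k - T p_k) = y0 - p_k]; a monotonicity argument shows that [p_k]
   is Cauchy, with a fixed point [l] as limit (Browder).  As [y n] is the
   projection of [y0] onto a half-space containing [l],
   [|y n - l|^2 <= 2 <y n - l, y0 - l>].  The right-hand side is close to
   [2 <y n - p_k, y0 - p_k>] for [k] large, and this is at most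
   [2 (k + 1) <y n - p_k, y n - T (y n)>] by monotonicity of [Id - T], which
   tends to [0] with [n] because [y n - T (y n)] does.

   Both Minty's theorem (the resolvents are defined everywhere) and the
   existence of projections come from minimizing [r + (|x|^2 + |u|^2) / 2] over
   a closed convex set of triples [(x, u, r)], which only needs completeness and
   the parallelogram identity. *)

(** * Real inequalities and convergence criteria *)

Lemma ge0_of_forall_small_slope (R : realType) (a b : R) :
  (forall t, 0 < t -> t <= 1 -> 0 <= a + t * b) -> 0 <= a.
Proof.
move=> h; rewrite leNgt; apply/negP => a0.
(* If [a < 0], the choice [t = - a / (|b| - a)] makes [a + t * b] at most [- a ^ 2 / (|b| - a)],
   which is negative. *)
have d0 : 0 < `|b| - a by have := normr_ge0 b; lra.
have t0 : 0 < - a / (`|b| - a) by rewrite divr_gt0 ?oppr_gt0.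
have t1 : - a / (`|b| - a) <= 1.
  by rewrite ler_pdivrMr // mul1r; have := normr_ge0 b; lra.
have := h _ t0 t1.
have le_tb : - a / (`|b| - a) * b <= - a / (`|b| - a) * `|b|.
  by rewrite ler_wpM2l ?ler_norm // ltW.
have eqa : - a / (`|b| - a) * `|b| = - a - a * (a / (`|b| - a)).
  by field; rewrite gt_eqF.
have : 0 < a * (a / (`|b| - a)).
  by rewrite mulrA -expr2 divr_gt0 // exprn_even_gt0 //= lt_eqF.
lra.
Qed.

Lemma cvg_of_dist_le (R : realType) (V : normedModType R) (T : Type)
    (F : set_system T) {FF : Filter F} (f : T -> V) (l : V) (g : T -> R) :
  g @ F --> 0 -> (forall t, `|l - f t| <= g t) -> f @ F --> l.
Proof.
move=> g0 fg; apply/cvgrPdist_le => e e0.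
move/cvgrPdist_le : g0 => /(_ _ e0); apply: filterS => t.
rewrite sub0r normrN; apply: le_trans; apply: le_trans (fg t) _.
exact: ler_norm.
Qed.

Lemma cvg_of_sq_dist (R : realType) (H : completeNormedModType R)
    (a : nat -> H) (e : nat -> R) :
    e @ \oo --> 0 -> (forall j k, `|a j - a k| ^+ 2 <= e j + e k) ->
  cvg (a @ \oo).
Proof.
move=> e0 ha; apply: cauchy_cvg; apply: cauchy_exP => eps eps0.
have eps2 : 0 < eps ^+ 2 / 4 by rewrite divr_gt0 // exprn_gt0.
move/cvgrPdist_le : e0 => /(_ _ eps2) [N _ hN].
have bnd k : (N <= k)%N -> e k <= eps ^+ 2 / 4.
  by move/hN => /=; rewrite sub0r normrN; apply: le_trans; exact: ler_norm.
exists (a N), N => // k /= Nk; rewrite -ball_normE /=.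
rewrite -(@ltr_pXn2r _ 2) ?nnegrE // ?ltW //.
have := ha N k; have := bnd _ Nk; have := bnd N (leqnn _); lra.
Qed.

Lemma cvg0_of_sq (R : realType) (V : normedModType R) (a : nat -> V) :
  (fun n => `|a n| ^+ 2) @ \oo --> 0 -> a @ \oo --> 0.
Proof.
move=> a0; apply/cvgrPdist_le => e e0.
have e2 : 0 < e ^+ 2 by rewrite exprn_gt0.
move/cvgrPdist_le : a0 => /(_ _ e2); apply: filterS => n.
rewrite !sub0r !normrN ger0_norm ?exprn_ge0 // ler_pXn2r ?nnegrE //.
exact: ltW.
Qed.

(** * Inner product and Cauchy-Schwarz inequality *)

Section Hilbert.
Context {R : realType} {H : completeNormedModType R} (dot : {dot H for idfun}).
Hypothesis norm_dot : forall u : H, `|u| ^+ 2 = dot u u.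
Implicit Types (u v w : H) (A B : H -> set H) (C : set H).

Let dotDl u v w : dot (u + v) w = dot u w + dot v w.
Proof. exact: linearDl. Qed.
Let dotDr u v w : dot w (u + v) = dot w u + dot w v.
Proof. exact: linearDr. Qed.
Let dotNl u w : dot (- u) w = - dot u w.
Proof. exact: linearNl. Qed.
Let dotNr u w : dot w (- u) = - dot w u.
Proof. exact: linearNr. Qed.
Let dotZl c u w : dot (c *: u) w = c * dot u w.
Proof. exact: linearZl_LR. Qed.
Let dotZr c u w : dot w (c *: u) = c * dot w u.
Proof. exact: linearZr_LR. Qed.
Let dot0l w : dot 0 w = 0.
Proof. exact: linear0l. Qed.
Let dot0r w : dot w 0 = 0.
Proof. exact: linear0r. Qed.
Let dotE := (norm_dot, dotDl, dotDr, dotNl, dotNr, dotZl, dotZr, dot0l, dot0r).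

Lemma dotC u v : dot u v = dot v u.
Proof. by rewrite (hermC dot) expr0 mul1r. Qed.

Lemma dotvv_ge0 u : 0 <= dot u u.
Proof. by rewrite -norm_dot exprn_ge0. Qed.

Lemma dotvv_le0_eq0 u : dot u u <= 0 -> u = 0.
Proof.
move=> h; apply/eqP; rewrite -normr_eq0 -sqrf_eq0.
by rewrite norm_dot eq_le h dotvv_ge0.
Qed.

(** The norm already satisfies the triangle inequality; squaring it and cancelling the squares
    leaves Cauchy-Schwarz. *)
Lemma le_dot_norm u v : dot u v <= `|u| * `|v|.
Proof.
have := lerXn2r 2 _ _ (ler_normD u v).
rewrite !nnegrE !normr_ge0 ?addr_ge0 // => /(_ isT isT).
rewrite sqrrD !dotE (dotC v u); lra.
Qed.

Lemma norm_dot_le u v : `|dot u v| <= `|u| * `|v|.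
Proof.
rewrite ler_norml le_dot_norm andbT.
have := le_dot_norm (- u) v; rewrite normrN dotNl; lra.
Qed.

Lemma cvg_dotl (T : Type) (F : set_system T) {FF : Filter F} (a : T -> H) p v :
  a @ F --> p -> (fun t => dot (a t) v) @ F --> dot p v.
Proof.
move=> ap; apply: (@cvg_of_dist_le R _ _ _ _ _ _ (fun t => `|p - a t| * `|v|)).
  rewrite -(mul0r `|v|); apply: cvgMr_tmp.
  rewrite -(normr0 H) -(subrr p).
  by apply: cvg_norm; apply: cvgB => //; exact: cvg_cst.
by move=> t; rewrite -linearBl norm_dot_le.
Qed.

(** * Quadratic minimization, projections and half-spaces *)

(** The quadratic term makes minimizing sequences Cauchy in [x] and [u]; the conclusion is the
    first-order optimality condition on the convex set [E]. *)
Lemma quadratic_minimizer (E : H -> H -> R -> Prop) (c : R) :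
    (exists x u r, E x u r) ->
    (forall x u r, E x u r -> c <= r + (`|x| ^+ 2 + `|u| ^+ 2) / 2) ->
    (forall t x u r x' u' r', 0 <= t -> t <= 1 -> E x u r -> E x' u' r' ->
      E (x + t *: (x' - x)) (u + t *: (u' - u)) (r + t * (r' - r))) ->
    (forall (x u : nat -> H) (r : nat -> R) p q s,
      (forall n, E (x n) (u n) (r n)) ->
      x @ \oo --> p -> u @ \oo --> q -> r @ \oo --> s -> E p q s) ->
  exists x u r, E x u r /\ forall x' u' r', E x' u' r' ->
    0 <= r' - r + dot x (x' - x) + dot u (u' - u).
Proof.
move=> [x0 [u0 [r0 E0]]] lbE convE closedE.
pose val (w : H * H * R) := w.2 + (`|w.1.1| ^+ 2 + `|w.1.2| ^+ 2) / 2.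
pose S := [set val w | w in [set w : H * H * R | E w.1.1 w.1.2 w.2]].
have infS : has_inf S.
  split; first by exists (val (x0, u0, r0)), (x0, u0, r0).
  by exists c => _ [[[a b] s] /= Es <-]; exact: lbE.
pose m := inf S.
have le_m a b s : E a b s -> m <= s + (`|a| ^+ 2 + `|b| ^+ 2) / 2.
  by move=> Es; apply: ge_inf; [exact: infS.2|exists (a, b, s)].
have /boolp.choice [w hw] : forall n, exists w : H * H * R,
    E w.1.1 w.1.2 w.2 /\ val w < m + harmonic n.
  move=> n.
  have [_ [w Ew <-] lt_w] := inf_adherent (harmonic_gt0 n) infS.
  by exists w.
pose x n := (w n).1.1; pose u n := (w n).1.2; pose r n := (w n).2.
have Ew n : E (x n) (u n) (r n) by exact: (hw n).1.
have ltw n : r n + (`|x n| ^+ 2 + `|u n| ^+ 2) / 2 < m + harmonic n.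
  exact: (hw n).2.
(* By the parallelogram identity, the value at a midpoint is the mean of the two values minus an
   eighth of the left-hand side, and it is at least [m]. *)
have dist j k : `|x j - x k| ^+ 2 + `|u j - u k| ^+ 2
    <= 4 * harmonic j + 4 * harmonic k.
  have /le_m : E (x j + 2^-1 *: (x k - x j)) (u j + 2^-1 *: (u k - u j))
                 (r j + 2^-1 * (r k - r j)) by apply: convE => //; lra.
  have := ltw j; have := ltw k; rewrite !dotE.
  by rewrite (dotC (x k) (x j)) (dotC (u k) (u j)); lra.
have h0 : (fun n => 4 * harmonic n : R) @ \oo --> 0.
  by rewrite -(mulr0 4); apply: cvgMl_tmp; exact: cvg_harmonic.
have /cvg_ex [p xp] : cvg (x @ \oo).
  apply: (cvg_of_sq_dist h0) => j k; apply: le_trans (dist j k).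
  by rewrite lerDl exprn_ge0.
have /cvg_ex [q uq] : cvg (u @ \oo).
  apply: (cvg_of_sq_dist h0) => j k; apply: le_trans (dist j k).
  by rewrite lerDr exprn_ge0.
have sqr_cvg (a : nat -> H) l :
    a @ \oo --> l -> (fun n => `|a n| ^+ 2) @ \oo --> `|l| ^+ 2.
  move=> al; rewrite expr2; under eq_fun do rewrite expr2.
  by apply: cvgM; exact: cvg_norm.
(* The limit of [r] is forced, since the values tend to [m] and the norms converge. *)
pose s := m - (`|p| ^+ 2 + `|q| ^+ 2) / 2.
have rs : r @ \oo --> s.
  pose v n := r n + (`|x n| ^+ 2 + `|u n| ^+ 2) / 2.
  have vm : v @ \oo --> m.
    apply: (@cvg_of_dist_le R _ _ _ _ _ _ harmonic); first exact: cvg_harmonic.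
    move=> n; rewrite ler_norml; have := le_m _ _ _ (Ew n); have := ltw n.
    by rewrite -/(v n); lra.
  have -> : r = fun n => v n - (`|x n| ^+ 2 + `|u n| ^+ 2) / 2.
    by apply/funext => n; rewrite /v addrK.
  by apply: cvgB => //; apply: cvgMr_tmp; apply: cvgD; exact: sqr_cvg.
have Epqs : E p q s by exact: closedE Ew xp uq rs.
exists p, q, s; split=> // x' u' r' E'.
(* Moving a fraction [t] towards [(x', u', r')] raises the value by [t] times (slope plus [t] times
   this constant). *)
apply: (@ge0_of_forall_small_slope R _ ((`|x' - p| ^+ 2 + `|u' - q| ^+ 2) / 2)).
move=> t t0 t1; have /le_m := convE _ _ _ _ _ _ _ (ltW t0) t1 Epqs E'.
rewrite -(pmulr_rge0 _ t0) /s !dotE (dotC x' p) (dotC u' q); lra.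
Qed.

Lemma projectionP C x :
    C !=set0 -> closed C ->
    (forall t u v, 0 <= t -> t <= 1 -> C u -> C v -> C (u + t *: (v - u))) ->
  C (projection C x) /\
  forall w, C w -> dot (w - projection C x) (x - projection C x) <= 0.
Proof.
move=> [w0 Cw0] closedC convC.
(* The unknown is the displacement [d] from [x]; the other two coordinates are frozen at [0]. *)
pose E d u (r : R) := [/\ C (x + d), u = 0 & r = 0].
have [||||d [_ [_ [[Cxd -> ->] min_d]]]] := @quadratic_minimizer E 0.
- by exists (w0 - x), 0, 0; split=> //; rewrite addrC subrK.
- move=> d u r [_ -> ->]; rewrite normr0 expr0n addr0 add0r.
  by rewrite divr_ge0 ?exprn_ge0.
- move=> t d u r d' u' r' t0 t1 [Cd -> ->] [Cd' -> ->].
  split; rewrite ?subrr ?scaler0 ?mulr0 ?addr0 //.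
  have := convC t _ _ t0 t1 Cd Cd'.
  by rewrite [x + d']addrC addrKA addrA.
- move=> a u r p q s hE ap uq rs; split.
  + apply: (@closed_cvg _ _ \oo _ (fun n => x + a n) C closedC).
      by apply: nearW => n; case: (hE n).
    by apply: cvgD => //; exact: cvg_cst.
  + apply: (cvg_unique _ uq) => //.
    suff -> : u = fun=> 0 by exact: cvg_cst.
    by apply/funext => n; case: (hE n).
  + apply: (cvg_unique _ rs) => //.
    suff -> : r = fun=> 0 by exact: cvg_cst.
    by apply/funext => n; case: (hE n).
have [p Cp var_p] : exists2 p, C p & forall w, C w -> dot (w - p) (x - p) <= 0.
  exists (x + d) => // w Cw; have /min_d : E (w - x) 0 0.
    by split=> //; rewrite addrC subrK.
  rewrite !dotE (dotC d w) (dotC d x); lra.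
have proj_p : is_projection C x p.
  split=> // w /var_p var_w; rewrite -(@ler_pXn2r _ 2) ?nnegrE //.
  move: var_w; have := dotvv_ge0 (w - p); rewrite !dotE.
  rewrite (dotC x w) (dotC p w) (dotC p x); lra.
(* [xget] returns some projection; minimality of its distance and the variational inequality at [p]
   force it to equal [p]. *)
have [Cq /(_ _ Cp) q_min] : is_projection C x (projection C x).
  by apply: xgetPex; exists p.
suff -> : projection C x = p by [].
apply/eqP; rewrite -subr_eq0; apply/eqP/dotvv_le0_eq0.
have var_q := var_p _ Cq.
rewrite -(@ler_pXn2r _ 2) ?nnegrE // in q_min.
move: q_min var_q; move: (projection C x) => q; rewrite !dotE.
by rewrite (dotC x q) (dotC p q) (dotC p x); lra.
Qed.

Lemma half_space_closed x y : closed (half_space dot x y).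
Proof.
have cont : continuous (fun z => dot (z - y) (x - y)).
  by move=> z; apply: cvg_dotl; apply: cvgB; [exact: cvg_id|exact: cvg_cst].
by move/continuous_closedP: cont => /(_ _ (@closed_le R 0)).
Qed.

Lemma half_space_convex x y t u v : 0 <= t -> t <= 1 ->
  half_space dot x y u -> half_space dot x y v ->
  half_space dot x y (u + t *: (v - u)).
Proof.
rewrite /half_space /= => t0 t1 hu hv.
have s0 : 0 <= 1 - t by lra.
by have := mulr_ge0_le0 s0 hu; have := mulr_ge0_le0 t0 hv; rewrite !dotE; lra.
Qed.

(** The inclusion is the variational inequality of the projection, read as membership in a
    half-space. *)
Lemma haugazeauP x y z (C := half_space dot x y `&` half_space dot y z) :
    C !=set0 ->
  C (haugazeau dot x y z) /\ C `<=` half_space dot x (haugazeau dot x y z).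
Proof.
move=> C0; apply: projectionP => //.
  by apply: closedI; exact: half_space_closed.
by move=> t u v t0 t1 [? ?] [? ?]; split; exact: half_space_convex.
Qed.

(** * Maximal monotonicity, Minty's theorem and resolvents *)

Lemma maximally_monotone_mem A x u : maximally_monotone dot A ->
  (forall a b, A a b -> 0 <= dot (x - a) (u - b)) -> A x u.
Proof.
move=> [monoA maxA] rel_xu; apply: contrapT => nAxu.
pose N a : set H := A a `|` [set b | a = x /\ b = u].
apply: (maxA N).
  move=> a b a' b' [Aab|[-> ->]] [Aab'|[-> ->]].
  - exact: monoA.
  - by have := rel_xu _ _ Aab; rewrite !dotE; lra.
  - exact: rel_xu.
  - by rewrite !subrr dot0l.
split; first by move=> [a b]; left.
by move=> /(_ (x, u)); apply: contra_not nAxu; apply; right.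
Qed.

Lemma minty A gamma y : maximally_monotone dot A -> 0 < gamma ->
  exists x b, A x b /\ x + gamma *: b = y.
Proof.
move=> maxA g0.
(* If the graph were empty, [(0, 0)] would be vacuously related to it, so maximality would put it in
   the graph. *)
have [a0 [b0 Aab0]] : exists a b, A a b.
  apply: contrapT => noA; apply: (noA); exists 0, 0.
  apply: maximally_monotone_mem => // a b Aab.
  by case: noA; exists a, b.
(* [E] is the epigraph of the Fitzpatrick function of the operator whose graph
   consists of the pairs [(a - y, gamma *: b)] with [A a b]. *)
pose E x u r := forall a b, A a b ->
  gamma * dot x b + dot (a - y) u - gamma * dot (a - y) b <= r.
have graphE a b : A a b -> E (a - y) (gamma *: b) (gamma * dot (a - y) b).
  move=> Aab a' b' Aab'; have := maxA.1 _ _ _ _ Aab Aab'.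
  by rewrite -(pmulr_rge0 _ g0) !dotE; lra.
have mem_rel x u :
    (forall a b, A a b -> 0 <= dot (a - y - x) (gamma *: b - u)) ->
    A (x + y) (gamma^-1 *: u).
  move=> h; apply: maximally_monotone_mem => // a b /h.
  have -> : gamma *: b - u = gamma *: (b - gamma^-1 *: u).
    by rewrite scalerBr scalerA divff ?gt_eqF // scale1r.
  by rewrite dotZr pmulr_rge0 // !dotE; lra.
(* If [r < dot x u], the pair is monotonically related to the whole graph, hence belongs to it;
   testing [E] at that very pair then gives [dot x u <= r]. *)
have dot_le x u r : E x u r -> dot x u <= r.
  move=> Exu; rewrite leNgt; apply/negP => lt_r.
  have Axu : A (x + y) (gamma^-1 *: u).
    apply: mem_rel => a b /Exu.
    by rewrite !dotE; move: lt_r; lra.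
  have := Exu _ _ Axu.
  by rewrite addrK dotZr mulrA divff ?gt_eqF // mul1r; lra.
have [||||p [q [s [Epqs min_pqs]]]] := @quadratic_minimizer E 0.
- by exists (a0 - y), (gamma *: b0), (gamma * dot (a0 - y) b0); exact: graphE.
- move=> x u r /dot_le; have := dotvv_ge0 (x + u).
  by rewrite !dotE (dotC u x); lra.
- move=> t x u r x' u' r' t0 t1 Ex Ex' a b Aab.
  have s0 : 0 <= 1 - t by lra.
  have := Ex _ _ Aab; rewrite -subr_ge0 => /(mulr_ge0 s0).
  have := Ex' _ _ Aab; rewrite -subr_ge0 => /(mulr_ge0 t0).
  by rewrite !dotE; lra.
- move=> x u r p q s hE xp uq rs a b Aab.
  apply: (@ler_cvg_to _ \oo _ _ (fun n =>
    gamma * dot (x n) b + dot (a - y) (u n) - gamma * dot (a - y) b) r) => //.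
    apply: cvgB; last exact: cvg_cst.
    apply: cvgD; first by apply: cvgMl_tmp; exact: cvg_dotl.
    by rewrite dotC; under eq_fun do rewrite dotC; exact: cvg_dotl.
  by apply: nearW => n; exact: hE.
(* Optimality is tested at a point of the graph, using [dot p q <= s]. The bound puts [(- q, - p)]
   in the shifted and scaled graph, and at that point its right-hand side vanishes, so
   [p + q = 0]. *)
have key a b : A a b -> dot (p + q) (p + q) <= dot (a - y + q) (gamma *: b + p).
  move=> Aab; have := min_pqs _ _ _ (graphE _ _ Aab); have := dot_le _ _ _ Epqs.
  rewrite !dotE (dotC q p) (dotC p a) (dotC p y); lra.
have Aqp : A (- q + y) (gamma^-1 *: - p).
  apply: mem_rel => a b /key; rewrite !opprK; apply: le_trans.
  exact: dotvv_ge0.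
have := key _ _ Aqp.
rewrite addrK addNr dot0l => /dotvv_le0_eq0 pq0.
exists (- q + y), (gamma^-1 *: - p); split=> //.
rewrite scalerA divff ?gt_eqF // scale1r addrAC -opprD [q + p]addrC pq0.
by rewrite oppr0 add0r.
Qed.

(** Minty's theorem makes the set under [xget] nonempty, so the dummy value never intervenes. *)
Lemma resolventP A gamma y (x := resolvent (op_scale gamma A) y) :
  maximally_monotone dot A -> 0 < gamma -> A x (gamma^-1 *: (y - x)).
Proof.
move=> maxA g0.
have [z [b [Azb yE]]] := minty y maxA g0.
have : op_inv (op_add op_id (op_scale gamma A)) y x.
  apply: xgetPex; exists z.
  by exists z => //; exists (gamma *: b) => //; exists b.
move=> [_ -> [_ [c Axc <-] <-]].
by rewrite addrC addKr scalerA mulVf ?gt_eqF // scale1r.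
Qed.

(** * Firmly nonexpansive maps and Browder's approximating curve *)

Definition firmly_nonexpansive (T : H -> H) :=
  forall u v, 0 <= dot (T u - T v) ((u - T u) - (v - T v)).

Section FirmlyNonexpansive.
Variable T : H -> H.
Hypothesis firmT : firmly_nonexpansive T.

Lemma firmly_nonexpansive_dist u v : `|T u - T v| <= `|u - v|.
Proof.
rewrite -(@ler_pXn2r _ 2) ?nnegrE //.
have := firmT u v; have := dotvv_ge0 ((u - T u) - (v - T v)).
move: (T u) (T v) => a b; rewrite !dotE (dotC v u) (dotC a u) (dotC a v).
by rewrite (dotC b u) (dotC b v) (dotC b a); lra.
Qed.

Lemma cvg_firmly_nonexpansive (a : nat -> H) p :
  a @ \oo --> p -> (fun n => T (a n)) @ \oo --> T p.
Proof.
move=> ap.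
apply: (@cvg_of_dist_le R _ _ _ _ _ _ (fun n => `|p - a n|)).
  rewrite -(normr0 H) -(subrr p).
  by apply: cvg_norm; apply: cvgB => //; exact: cvg_cst.
by move=> n; exact: firmly_nonexpansive_dist.
Qed.

Lemma displacement_monotone u v : 0 <= dot (u - v) ((u - T u) - (v - T v)).
Proof.
have := firmT u v; have := dotvv_ge0 ((u - T u) - (v - T v)).
move: (T u) (T v) => a b; rewrite !dotE (dotC v u) (dotC a u) (dotC a v).
by rewrite (dotC b u) (dotC b v) (dotC b a); lra.
Qed.

(** The equation reads [w = (mu + 1)^-1 *: (y0 + mu *: T w)], a fixed-point equation for a
    contraction of constant [mu / (mu + 1)]. *)
Lemma displacement_resolvent y0 mu : 0 <= mu ->
  exists w, mu *: (w - T w) = y0 - w.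
Proof.
move=> mu0; have mu1 : 0 < mu + 1 by lra.
have q0 : 0 <= mu / (mu + 1) by rewrite divr_ge0 // ltW.
pose f w : H := (mu + 1)^-1 *: (y0 + mu *: T w).
have setf : set_fun [set: H] [set: H] f by [].
have ctrf : is_contraction (mkfun_fun setf).
  exists (NngNum q0); split => /=; first by rewrite ltr_pdivrMr // mul1r ltrDl.
  move=> [u v] _; change (`|f u - f v| <= mu / (mu + 1) * `|u - v|).
  have -> : f u - f v = (mu / (mu + 1)) *: (T u - T v).
    rewrite /f -scalerBr opprD addrACA subrr add0r -scalerBr scalerA.
    by rewrite mulrC.
  rewrite normrZ ger0_norm //; apply: ler_wpM2l => //.
  exact: firmly_nonexpansive_dist.
have [||w _ wE] := banach_fixed_point ctrf; [exact: closedT|by exists 0|].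
exists w; have : (mu + 1) *: w = y0 + mu *: T w.
  rewrite [in LHS]wE -[mkfun_fun _ _]/(f w) /f.
  by rewrite scalerA divff ?gt_eqF // scale1r.
rewrite scalerDl scale1r scalerBr => /eqP; rewrite -subr_eq => /eqP <-.
by rewrite [RHS]addrAC addrK.
Qed.

(** Through [norm_sq_le_of_dot_ge0], this keeps [w] no farther from [y0] than any fixed point,
    whatever [mu]. *)
Lemma dot_displacement_resolvent y0 mu w f : 0 <= mu ->
  mu *: (w - T w) = y0 - w -> T f = f -> 0 <= dot (w - f) (y0 - w).
Proof.
move=> mu0 <- Tf; rewrite dotZr mulr_ge0 //.
by have := displacement_monotone w f; rewrite Tf subrr subr0.
Qed.

(** Monotonicity of [Id - T], scaled by [mu * nu], gives [mu |w - v|^2 <= (nu - mu) <w - v, y0 -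
    w>]. The angle is thus not acute at [w], and expanding [|y0 - v|^2] concludes. *)
Lemma displacement_resolvent_dist y0 mu nu w v : 0 < mu -> mu < nu ->
  mu *: (w - T w) = y0 - w -> nu *: (v - T v) = y0 - v ->
  `|w - v| ^+ 2 <= `|y0 - v| ^+ 2 - `|y0 - w| ^+ 2.
Proof.
move=> mu0 lt_mn wE vE; have nu0 := lt_trans mu0 lt_mn.
have := displacement_monotone v w; rewrite -(pmulr_rge0 _ (mulr_gt0 mu0 nu0)).
have -> : mu * nu * dot (v - w) (v - T v - (w - T w)) =
    dot (v - w) (mu *: (y0 - v) - nu *: (y0 - w)).
  by rewrite -wE -vE !(dotDr, dotNr, dotZr); ring.
have -> : dot (v - w) (mu *: (y0 - v) - nu *: (y0 - w)) =
    (nu - mu) * dot (w - v) (y0 - w) - mu * dot (w - v) (w - v).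
  by rewrite !dotE; ring.
move=> h.
have : 0 <= dot (w - v) (y0 - w).
  rewrite -(@pmulr_rge0 _ (nu - mu)) ?subr_gt0 //.
  by have := mulr_ge0 (ltW mu0) (dotvv_ge0 (w - v)); lra.
by rewrite !dotE (dotC v w) (dotC v y0) (dotC w y0); lra.
Qed.

Lemma norm_sq_le_of_dot_ge0 u v w :
  0 <= dot (v - u) (w - v) -> `|w - v| ^+ 2 + `|v - u| ^+ 2 <= `|w - u| ^+ 2.
Proof.
by rewrite !dotE (dotC v u) (dotC w u) (dotC w v); lra.
Qed.

Lemma browder y0 f : T f = f ->
  exists (p : nat -> H) l, [/\ forall k, k.+1%:R *: (p k - T (p k)) = y0 - p k,
    p @ \oo --> l & T l = l].
Proof.
move=> Tf.
have /boolp.choice [p pE] : forall k : nat, exists w,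
    k.+1%:R *: (w - T w) = y0 - w.
  by move=> k; exact: displacement_resolvent.
pose D k := `|y0 - p k| ^+ 2.
have D_le k : D k <= `|y0 - f| ^+ 2.
  have := norm_sq_le_of_dot_ge0 (dot_displacement_resolvent _ (pE k) Tf).
  move=> /(_ (ler0n _ _)); have : 0 <= `|p k - f| ^+ 2 by rewrite exprn_ge0.
  rewrite /D; lra.
have dist j k : (j < k)%N -> `|p j - p k| ^+ 2 <= D k - D j.
  move=> lt_jk; apply: displacement_resolvent_dist (pE j) (pE k).
    by rewrite ltr0n.
  by rewrite ltr_nat.
have D_homo : {homo D : j k / (j <= k)%N >-> j <= k}.
  move=> j k; rewrite leq_eqVlt => /predU1P[-> //|/dist h].
  by rewrite -subr_ge0; apply: le_trans h; rewrite exprn_ge0.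
have D_cvg : cvgn D.
  apply: nondecreasing_is_cvgn => //.
  by exists (`|y0 - f| ^+ 2) => _ [k _ <-].
pose L := limn D.
have D_leL k : D k <= L by exact: nondecreasing_cvgn_le.
have e0 : (fun k => L - D k) @ \oo --> 0.
  by rewrite -(subrr L); apply: cvgB; [exact: cvg_cst|exact: D_cvg].
have /cvg_ex [l pl] : cvg (p @ \oo).
  (* For [j < k], [D k - D j] is at most [L - D j], hence at most the sum of both gaps to [L]. *)
  apply: (cvg_of_sq_dist e0) => j k.
  have := D_leL j; have := D_leL k.
  case: (ltngtP j k) => [/dist|/dist|->].
  - lra.
  - by rewrite distrC; lra.
  - by rewrite subrr normr0 expr0n /=; lra.
exists p, l; split=> //.
have Gp0 : (fun k => p k - T (p k)) @ \oo --> 0.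
  apply: (@cvg_of_dist_le R _ _ _ _ _ _ (fun k => harmonic k * `|y0 - f|)).
    by rewrite -(mul0r `|y0 - f|); apply: cvgMr_tmp; exact: cvg_harmonic.
  move=> k; rewrite sub0r normrN.
  have -> : p k - T (p k) = harmonic k *: (y0 - p k).
    by rewrite -pE scalerA mulVf ?scale1r // pnatr_eq0.
  rewrite normrZ ger0_norm ?harmonic_ge0 // ler_wpM2l ?harmonic_ge0 //.
  by rewrite -(@ler_pXn2r _ 2) ?nnegrE //; exact: D_le.
have GpTl : (fun k => p k - T (p k)) @ \oo --> l - T l.
  by apply: cvgB => //; exact: cvg_firmly_nonexpansive.
apply/eqP; rewrite eq_sym -subr_eq0; apply/eqP.
by apply: (cvg_unique _ GpTl).
Qed.

(** * Strong convergence of Haugazeau's method *)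

Lemma haugazeau_cvg (y0 : H) (lambda : nat -> R) (delta : R) (y : nat -> H) :
    (exists f, T f = f) -> 0 < delta ->
    (forall n, delta <= lambda n <= 1) -> y 0%N = y0 ->
    (forall n, y n.+1 = haugazeau dot y0 (y n)
                          (y n + lambda n *: (T (y n) - y n))) ->
  exists2 l, T l = l & y @ \oo --> l.
Proof.
move=> [f Tf] delta0 lambda_bnd y_0 yS.
have [p [l [pE pl Tl]]] := browder y0 Tf.
exists l => //.
pose d n := T (y n) - y n.
pose Q n := half_space dot y0 (y n) `&`
  half_space dot (y n) (y n + lambda n *: d n).
(* Firmness at the fixed point [l] gives [<l - y n, d n> >= |d n|^2], and [lambda n <= 1] weakens
   this to the cut. *)
have cut n : half_space dot (y n) (y n + lambda n *: d n) l.
  rewrite /half_space /=.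
  have /andP[la1 la2] := lambda_bnd n; have la0 := lt_le_trans delta0 la1.
  have -> : y n - (y n + lambda n *: d n) = - lambda n *: d n.
    by rewrite opprD addrA subrr add0r scaleNr.
  rewrite dotZr mulNr oppr_le0 mulr_ge0 ?(ltW la0) //.
  have hT : 0 <= dot (l - T (y n)) (d n).
    by have := firmT l (y n); rewrite Tl subrr sub0r opprB.
  have := mulr_ge0 (_ : 0 <= 1 - lambda n) (dotvv_ge0 (d n)).
  rewrite subr_ge0 => /(_ la2); move: hT.
  rewrite {1}(_ : T (y n) = y n + d n); last by rewrite addrC subrK.
  by rewrite !dotE; lra.
(* Initially the first half-space is all of [H], as [y 0 = y0]; later it contains the previous
   [Q n], hence [l]. *)
have Ql n : Q n l.
  elim: n => [|n IHn]; split=> //.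
    by rewrite /half_space /= y_0 subrr dot0r.
  rewrite yS; have [_] := haugazeauP (ex_intro _ _ IHn); exact.
have yQ n : Q n (y n.+1).
  by rewrite yS; have [] := haugazeauP (ex_intro _ _ (Ql n)).
pose rho := `|y0 - l|; have rho0 : 0 <= rho by exact: normr_ge0.
pose D n := `|y n - y0| ^+ 2.
have D_le n : D n <= rho ^+ 2.
  have := (Ql n).1; rewrite /half_space /= /D /rho distrC => h.
  have := @norm_sq_le_of_dot_ge0 l (y n) y0.
  have : 0 <= `|y n - l| ^+ 2 by rewrite exprn_ge0.
  by rewrite -oppr_ge0 -dotNl opprB in h; move=> + /(_ h); lra.
have D_step n : `|y n.+1 - y n| ^+ 2 <= D n.+1 - D n.
  have := (yQ n).1; rewrite /half_space /= /D => h.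
  have := @norm_sq_le_of_dot_ge0 y0 (y n) (y n.+1).
  rewrite dotC -oppr_le0 -dotNr opprB => /(_ h); lra.
have D_cvg : cvgn D.
  apply: nondecreasing_is_cvgn.
    apply/nondecreasing_seqP => n; rewrite -subr_ge0.
    by apply: le_trans (D_step n); rewrite exprn_ge0.
  by exists (rho ^+ 2) => _ [k _ <-].
(* The second cut at [y n.+1] reads [lambda n |d n|^2 <= <y n.+1 - y n, d n>]; Cauchy-Schwarz then
   allows division by [|d n|]. *)
have d_le n : delta * `|d n| <= `|y n.+1 - y n|.
  have := (yQ n).2; rewrite /half_space /=.
  have /andP[la1 la2] := lambda_bnd n; have la0 := lt_le_trans delta0 la1.
  have -> : y n - (y n + lambda n *: d n) = - lambda n *: d n.
    by rewrite opprD addrA subrr add0r scaleNr.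
  rewrite dotZr mulNr oppr_le0 pmulr_rge0 // opprD addrA dotDl dotNl dotZl.
  rewrite -norm_dot subr_ge0 => h.
  have [->|d0] := eqVneq (d n) 0; first by rewrite normr0 mulr0.
  have nd0 : 0 < `|d n| by rewrite normr_gt0.
  rewrite -(ler_pM2r nd0) -mulrA -expr2.
  apply: le_trans (le_dot_norm _ _); apply: le_trans h.
  by rewrite ler_wpM2r ?exprn_ge0.
have d0 : d @ \oo --> 0.
  apply: cvg0_of_sq.
  apply: (@cvg_of_dist_le R _ _ _ _ _ _ (fun n => delta ^- 2 * (D n.+1 - D n))).
    rewrite -(mulr0 (delta ^- 2)); apply: cvgMl_tmp.
    rewrite -(subrr (limn D)); apply: cvgB => //.
    by rewrite (cvg_shiftS D).
  move=> n; rewrite sub0r normrN ger0_norm ?exprn_ge0 //.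
  rewrite ler_pdivlMl ?exprn_gt0 // -exprMn; apply: le_trans (D_step n).
  by rewrite ler_pXn2r ?nnegrE ?mulr_ge0 // ltW.
have y_le n : `|y n - y0| <= rho.
  by rewrite -(@ler_pXn2r _ 2) ?nnegrE //; exact: D_le.
have p_le k : `|y0 - p k| <= rho.
  have :=
    norm_sq_le_of_dot_ge0 (dot_displacement_resolvent (ler0n _ _) (pE k) Tl).
  have : 0 <= `|p k - l| ^+ 2 by rewrite exprn_ge0.
  move=> h1 h2; rewrite -(@ler_pXn2r _ 2) ?nnegrE //.
  by apply: le_trans h2; rewrite lerDl.
(* Since [y n], [p k] and [l] are all within [rho] of [y0], the constants arise by doubling: [6] is
   twice [1 + 2] from [h3] and [h4], and [4] is twice the [2] of [h5]. *)
have main n k :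
    `|y n - l| ^+ 2 <= 6 * rho * `|p k - l| + 4 * rho * k.+1%:R * `|d n|.
  have h1 : `|y n - l| ^+ 2 <= 2 * dot (y n - l) (y0 - l).
    have := D_le n; rewrite /D /rho !dotE.
    by rewrite (dotC y0 (y n)) (dotC l (y n)) (dotC l y0); lra.
  have h2 : dot (y n - l) (y0 - l) = dot (y n - p k) (y0 - p k) +
      dot (p k - l) (y0 - p k) + dot (y n - l) (p k - l).
    by rewrite !dotE; ring.
  have h3 : dot (p k - l) (y0 - p k) <= rho * `|p k - l|.
    apply: le_trans (le_dot_norm _ _) _.
    by rewrite mulrC ler_wpM2r.
  have y_le2 v : `|y0 - v| <= rho -> `|y n - v| <= 2 * rho.
    move=> hv; have := ler_distD y0 (y n) v; have := y_le n; lra.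
  have h4 : dot (y n - l) (p k - l) <= 2 * rho * `|p k - l|.
    apply: le_trans (le_dot_norm _ _) _.
    by rewrite ler_wpM2r // y_le2.
  have h5 : dot (y n - p k) (y0 - p k) <= k.+1%:R * (2 * rho * `|d n|).
    rewrite -pE dotZr ler_wpM2l //.
    have := displacement_monotone (y n) (p k); rewrite dotDr dotNr subr_ge0.
    move=> /le_trans; apply; apply: le_trans (le_dot_norm _ _) _.
    by rewrite distrC [`|y n - T _|]distrC ler_wpM2r // distrC y_le2.
  lra.
apply/subr_cvg0/cvg0_of_sq/cvgrPdist_le => e e_gt0; have e2 : 0 < e / 2 by lra.
have pl0 : (fun k => 6 * rho * `|p k - l|) @ \oo --> 0.
  rewrite -(mulr0 (6 * rho)); apply: cvgMl_tmp; rewrite -(normr0 H) -(subrr l).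
  by apply: cvg_norm; apply: cvgB => //; exact: cvg_cst.
(* The index [k] is fixed first; only then is [n] taken large, as the second term grows with [k]. *)
have [k _ /(_ k (leqnn k))] := (cvgrPdist_le _ _).1 pl0 _ e2.
rewrite /= sub0r normrN => /(le_trans (ler_norm _)) le_k.
have dk0 : (fun n => 4 * rho * k.+1%:R * `|d n|) @ \oo --> 0.
  rewrite -(mulr0 (4 * rho * k.+1%:R)); apply: cvgMl_tmp; rewrite -(normr0 H).
  exact: cvg_norm.
apply: filterS ((cvgrPdist_le _ _).1 dk0 _ e2) => n.
rewrite !sub0r !normrN => /(le_trans (ler_norm _)) le_n.
rewrite ger0_norm ?exprn_ge0 //; have := main n k; lra.
Qed.


End FirmlyNonexpansive.

(** * Resolvents and the Douglas-Rachford operator *)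

Lemma resolvent_firmly_nonexpansive A gamma :
  maximally_monotone dot A -> 0 < gamma ->
  firmly_nonexpansive (resolvent (op_scale gamma A)).
Proof.
move=> maxA g0 u v.
have := maxA.1 _ _ _ _ (resolventP u maxA g0) (resolventP v maxA g0).
by rewrite -scalerBr dotZr pmulr_rge0 // invr_gt0.
Qed.

Lemma resolvent_eq A gamma x b : maximally_monotone dot A -> 0 < gamma ->
  A x b -> resolvent (op_scale gamma A) (x + gamma *: b) = x.
Proof.
move=> maxA g0 Axb; apply/eqP; rewrite -subr_eq0; apply/eqP/dotvv_le0_eq0.
have := maxA.1 _ _ _ _ (resolventP (x + gamma *: b) maxA g0) Axb.
move: (resolvent _ _) => w; rewrite -(pmulr_rge0 _ g0) -dotZr.
have -> : gamma *: (gamma^-1 *: (x + gamma *: b - w) - b) = x - w.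
  rewrite scalerBr scalerA divff ?gt_eqF // scale1r.
  by rewrite addrAC addrK.
by rewrite -(opprB w x) dotNr oppr_ge0.
Qed.

Section DouglasRachford.
Variables (A B : H -> set H) (gamma : R).
Hypotheses (maxA : maximally_monotone dot A) (maxB : maximally_monotone dot B).
Hypothesis gamma_gt0 : 0 < gamma.
Let JA := resolvent (op_scale gamma A).
Let JB := resolvent (op_scale gamma B).

(** This is the average of the identity and the composition of the reflections [2 JA - Id] and
    [2 JB - Id]. *)
Definition douglas_rachford v := v + (JA (2 *: JB v - v) - JB v).

(** For the differences [v], [x], [z] of the inputs, of the [JB] values and of the [JA] values, [<v
    + z - x, x - z> = <x, v - x> + <z, 2 x - v - z>], a sum of the two firmness terms. *)
Lemma douglas_rachford_firmly_nonexpansive :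
  firmly_nonexpansive douglas_rachford.
Proof.
move=> v v'; rewrite /douglas_rachford.
have := resolvent_firmly_nonexpansive maxB gamma_gt0 v v'; rewrite -/JB.
move: (JB v) (JB v') => x x'.
have := resolvent_firmly_nonexpansive maxA gamma_gt0
  (2 *: x - v) (2 *: x' - v').
rewrite -/JA; move: (JA _) (JA _) => z z'; rewrite !dotE.
rewrite (dotC v' v) (dotC x v) (dotC x v') (dotC x' v) (dotC x' v') (dotC x' x).
rewrite (dotC z v) (dotC z v') (dotC z x) (dotC z x').
by rewrite (dotC z' v) (dotC z' v') (dotC z' x) (dotC z' x') (dotC z' z); lra.
Qed.

Lemma douglas_rachford_fixed p :
  zer (op_add A B) p -> exists f, douglas_rachford f = f.
Proof.
(* [JB] sends this point to [p], and its reflection is [p + gamma *: a] because [a = - b], which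
   [JA] also sends to [p]. *)
move=> [a Apa [b Bpb ab0]]; exists (p + gamma *: b).
rewrite /douglas_rachford /JB resolvent_eq //.
have -> : 2 *: p - (p + gamma *: b) = p + gamma *: a.
  rewrite scaler_nat mulr2n opprD addrA addrK; congr (p + _).
  by rewrite -scalerN; congr (_ *: _); apply/esym/eqP; rewrite -addr_eq0 ab0.
by rewrite /JA resolvent_eq // subrr addr0.
Qed.

Lemma douglas_rachford_fixed_solutions l (b := gamma^-1 *: (l - JB l)) :
  douglas_rachford l = l -> A (JB l) (- b) /\ B (JB l) b.
Proof.
rewrite /douglas_rachford => /eqP.
rewrite -subr_eq0 addrAC subrr add0r subr_eq0 => /eqP zE.
split; last exact: resolventP.
have := resolventP (2 *: JB l - l) maxA gamma_gt0; rewrite -/JA zE.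
by rewrite scaler_nat mulr2n addrAC addrK -opprB scalerN.
Qed.

End DouglasRachford.

End Hilbert.

Theorem theorem6p6 (R : realType) (H : completeNormedModType R)
    (dot : {dot H for idfun})
    (norm_dot : forall u : H, `|u| ^+ 2 = dot u u)
    (A B : H -> set H)
    (A_maxmono : Defs.maximally_monotone dot A)
    (B_maxmono : Defs.maximally_monotone dot B)
    (zer_neq0 : Defs.zer (Defs.op_add A B) !=set0)
    (y0 : H) (lambda : nat -> R)
    (lambda01 : forall n, 0 < lambda n <= 1)
    (inf_lambda : 0 < inf (range lambda))
    (gamma : R) (gamma_gt0 : 0 < gamma)
    (x xs z y : nat -> H)
    (y_0 : y 0%N = y0)
    (x_def : forall n, x n = Defs.resolvent (Defs.op_scale gamma B) (y n))
    (xs_def : forall n, xs n = gamma^-1 *: (y n - x n))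
    (z_def : forall n,
      z n = Defs.resolvent (Defs.op_scale gamma A) (2 *: x n - y n))
    (y_def : forall n,
      y n.+1 = Defs.haugazeau dot y0 (y n) (y n + lambda n *: (z n - x n))) :
  (exists2 p : H, Defs.primal_solutions A B p & x @ \oo --> p) /\
  (exists2 p : H, Defs.dual_solutions A B p & xs @ \oo --> p).
Proof.
pose T := douglas_rachford A B gamma.
have [l Tl yl] : exists2 l, T l = l & y @ \oo --> l.
  apply: (haugazeau_cvg (lambda := lambda) norm_dot _ _ inf_lambda
    _ y_0) => [|||n].
  - exact: douglas_rachford_firmly_nonexpansive.
  - by case: zer_neq0 => p; exact: douglas_rachford_fixed.
  - move=> n; have /andP[_ ->] := lambda01 n; rewrite andbT.
    (* The infimum of [lambda] acts as [delta]; it is a lower bound because the range is bounded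
       below by [0]. *)
    apply: ge_inf; last by exists n.
    by exists 0 => _ [k _ <-]; have /andP[/ltW] := lambda01 k.
  - have <- : z n - x n = T (y n) - y n.
      by rewrite z_def x_def [RHS]addrAC subrr add0r.
    exact: y_def.
pose JB := resolvent (op_scale gamma B).
have xl : x @ \oo --> JB l.
  rewrite (_ : x = fun n => JB (y n)); last exact/funext.
  apply: (cvg_firmly_nonexpansive norm_dot) yl.
  exact: resolvent_firmly_nonexpansive.
have [Al Bl] :=
  douglas_rachford_fixed_solutions norm_dot A_maxmono B_maxmono gamma_gt0 Tl.
split; [exists (JB l) => //|exists (gamma^-1 *: (l - JB l))].
- exists (- (gamma^-1 *: (l - JB l))) => //.
  by exists (gamma^-1 *: (l - JB l)) => //; rewrite addNr.
(* The same [JB l] lies in [A^-1] of the negated dual point and in [B^-1] of the dual point, so the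
   two terms cancel. *)
- exists (- JB l); first by exists (JB l).
  by exists (JB l) => //; rewrite addNr.
- rewrite (_ : xs = fun n => gamma^-1 *: (y n - x n)); last exact/funext.
  by apply: cvgZl_tmp; exact: cvgB yl xl.
Qed.
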